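(* Let $\mathfrak{U}$ be a Grothendieck universe that contains an infinite set, let $G$ be a group in $\mathfrak{U}$ and let $M$ be an abelian $G$-module in $\mathfrak{U}$. The maps $$\mathrm{cl}\colon \mathrm{Ext}^2_{\mathfrak{U}}(G,M)\to H^3_{\mathrm{cpt}}(G,M),\quad [E]\mapsto \mathrm{cl}(E),$$ $$\mathrm{e}\colon H^3_{\mathrm{cpt}}(G,M)\to \mathrm{Ext}^2_{\mathfrak{U}}(G,M),\quad z^3+B^3_{\mathrm{cpt}}(G,M)\mapsto [\mathrm{E}(z^3)],$$ are mutually inverse bijections, under which the extension class of the trivial crossed module extension $[M\;G]$ corresponds to the trivial cohomology class $0\in H^3_{\mathrm{cpt}}(G,M)$. In particular, there is a bijection $\mathrm{Ext}^2_{\mathfrak{U}}(G,M)\cong H^3(G,M)$.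
   Context: Cochains. An abelian $G$-module $M$ is an abelian group (written additively) with a left action of $G$ by group automorphisms. $\mathrm{Ch}^n(G,M)=\mathrm{Map}(G^n,M)$; elements of $G^n$ are written $(g_{n-1},\dots,g_0)$. The differential $\partial\colon \mathrm{Ch}^n\to\mathrm{Ch}^{n+1}$ is $$(\partial c)(g_n,\dots,g_0)=c(g_n,\dots,g_1)+\sum_{k=1}^n(-1)^k c(g_n,\dots,g_{k+1},g_kg_{k-1},g_{k-2},\dots,g_0)+(-1)^{n+1}g_n\cdot c(g_{n-1},\dots,g_0).$$ $Z^n,B^n,H^n=Z^n/B^n$ are the cocycle, coboundary and cohomology groups. A map out of a product of pointed sets is componentwise pointed if it takes the distinguished value whenever some component is the distinguished point (distinguished points of groups are neutral elements). $\mathrm{Ch}^n_{\mathrm{cpt}}(G,M)$ is the set of componentwise pointed cochains, $Z^n_{\mathrm{cpt}}=\mathrm{Ch}^n_{\mathrm{cpt}}\cap Z^n$, $B^n_{\mathrm{cpt}}=\mathrm{Ch}^n_{\mathrm{cpt}}\cap B^n$, $H^n_{\mathrm{cpt}}=Z^n_{\mathrm{cpt}}/B^n_{\mathrm{cpt}}$. Crossed modules. A crossed module $V$ consists of a group $\mathrm{Gp}\,V$ (group part), a (not necessarily abelian) group $\mathrm{Mp}\,V$ (module part) on which $\mathrm{Gp}\,V$ acts from the left by automorphisms, written ${}^g m$, and a homomorphism $\mu=\mu^V\colon\mathrm{Mp}\,V\to\mathrm{Gp}\,V$ with $\mu({}^gm)=g\mu(m)g^{-1}$ and ${}^{\mu(n)}m=nmn^{-1}$.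 A morphism $\varphi\colon V\to W$ consists of homomorphisms $\mathrm{Gp}\,\varphi$, $\mathrm{Mp}\,\varphi$ between group parts and module parts, with $\mu^W\circ\mathrm{Mp}\,\varphi=\mathrm{Gp}\,\varphi\circ\mu^V$ and $(\mathrm{Mp}\,\varphi)({}^gm)={}^{(\mathrm{Gp}\,\varphi)(g)}((\mathrm{Mp}\,\varphi)(m))$. Extensions. A crossed module extension $E$ of $G$ with $M$ is a crossed module $E$ with a monomorphism $\iota=\iota^E\colon M\to\mathrm{Mp}\,E$ and an epimorphism $\pi=\pi^E\colon\mathrm{Gp}\,E\to G$ such that $M\xrightarrow{\iota}\mathrm{Mp}\,E\xrightarrow{\mu}\mathrm{Gp}\,E\xrightarrow{\pi}G$ is exact and ${}^e\iota(m)=\iota(\pi(e)\cdot m)$ for $e\in\mathrm{Gp}\,E$, $m\in M$. It is in $\mathfrak{U}$ if its underlying groups are. An extension equivalence $\varphi\colon E\to\tilde E$ is a crossed module morphism with $\mathrm{Mp}\,\varphi\circ\iota^E=\iota^{\tilde E}$ and $\pi^{\tilde E}\circ\mathrm{Gp}\,\varphi=\pi^E$. On the set of crossed module extensions of $G$ with $M$ in $\mathfrak{U}$, let $\approx$ be the equivalence relation generated by: $E$ is related to $\tilde E$ if there is an extension equivalence $E\to\tilde E$. $\mathrm{Ext}^2_{\mathfrak{U}}(G,M)$ is the set of $\approx$-classes $[E]$. The trivial crossed module extension $[M\;G]$ has module part $M$, group part $G$, the given action, trivial structure morphism, $\iota=\mathrm{id}_M$, $\pi=\mathrm{id}_G$.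 The map $\mathrm{cl}$. A lifting system $(Z^2,Z^1)$ for $E$ consists of a pointed map $Z^1\colon G\to\mathrm{Gp}\,E$ with $\pi\circ Z^1=\mathrm{id}_G$ and a componentwise pointed map $Z^2\colon G\times G\to\mathrm{Mp}\,E$ with $\mu(Z^2(h,g))=Z^1(h)Z^1(g)Z^1(hg)^{-1}$. The 3-cocycle of $E$ with respect to it is the element $\mathrm{z}^3_{E,(Z^2,Z^1)}\in Z^3_{\mathrm{cpt}}(G,M)$ given by $$(k,h,g)\mapsto\iota^{-1}\big(Z^2(k,h)\,Z^2(kh,g)\,Z^2(k,hg)^{-1}\,({}^{Z^1(k)}Z^2(h,g))^{-1}\big).$$ $\mathrm{cl}(E)\in H^3_{\mathrm{cpt}}(G,M)$ is its cohomology class; it is independent of the lifting system and depends only on $[E]$. The map $\mathrm{e}$. For $z^3\in Z^3_{\mathrm{cpt}}(G,M)$ the standard extension $\mathrm{E}(z^3)$ is: $\mathrm{Gp}\,\mathrm{E}(z^3)=F$, a free group on the pointed set $G$ with basis $s^0\colon G\to F$ (so $s^0(1)=1$ and $F$ is free on the $s^0(g)$, $g\neq1$); $\pi\colon F\to G$ is the homomorphism with $\pi(s^0(g))=g$; $\mathrm{Mp}\,\mathrm{E}(z^3)=M\times\mathrm{Ker}\,\pi$, $\mu(m,r)=r$, $\iota(m)=(m,1)$; with $\mathrm{z}^2(h,g)=s^0(h)s^0(g)s^0(hg)^{-1}$, the action of $F$ on $M\times\mathrm{Ker}\,\pi$ is the unique one with ${}^{s^0(k)}(m,1)=(k\cdot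 m,1)$ and ${}^{s^0(k)}(0,\mathrm{z}^2(h,g))=(-z^3(k,h,g),\,s^0(k)\mathrm{z}^2(h,g)s^0(k)^{-1})$ for $m\in M$, $g,h,k\in G$. The free group is taken in $\mathfrak{U}$. The class $[\mathrm{E}(z^3)]$ depends only on the cohomology class of $z^3$. *)

(* Defs.v *)
From HB Require Import structures.
From Stdlib Require Import Relation_Definitions Relation_Operators.
From mathcomp Require Import all_boot ssralg ssrint.
From mathcomp Require Import boolp classical_sets functions cardinality.

Set Implicit Arguments.
Unset Strict Implicit.
Unset Printing Implicit Defensive.

Import GRing.Theory.
Local Open Scope group_scope.

Notation group_hom := monoid.UMagmaMorphism.type.

(** The set of classes [R x], for an equivalence relation [R]. *)
Definition quotient_set (T : Type) (R : T -> T -> Prop) : Type :=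
  {C : T -> Prop | exists x, C = R x}.

Definition class_of (T : Type) (R : T -> T -> Prop) (x : T) : quotient_set R :=
  exist _ (R x) (ex_intro _ x erefl).

Definition class_repr (T : Type) (R : T -> T -> Prop) (C : quotient_set R) : T :=
  projT1 (cid (proj2_sig C)).

Lemma class_of_eq (T : Type) (R : T -> T -> Prop) : equivalence T R ->
  forall x y, class_of R x = class_of R y <-> R x y.
Proof.
move=> [Rr Rt Rs] x y; split=> [/(congr1 (@proj1_sig _ _)) /= ->|Rxy]; first exact: Rr.
rewrite /class_of; apply: eq_exist; apply/funext => z; apply/propext.
by split; apply: Rt => //; apply: Rs.
Qed.

Lemma class_reprK (T : Type) (R : T -> T -> Prop) (C : quotient_set R) :
  class_of R (class_repr C) = C.
Proof.
rewrite /class_of /class_repr; case: C => C exC /=.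
by apply: eq_exist; case: cid.
Qed.

(** Types carry no global membership relation, so a Grothendieck universe is
    represented by the class [U] of types that are small with respect to it.
    Closure under injections covers both closure under subsets and invariance
    under bijections; with [gu_sum] it also covers replacement and unions of
    families, since an image injects into its source and a union of a family
    into its disjoint sum. *)
Record grothendieck_universe (U : Type -> Prop) : Prop := {
  gu_inj : forall (A B : Type) (f : A -> B), injective f -> U B -> U A;
  gu_pair : U bool;
  gu_pow : forall A : Type, U A -> U (A -> Prop);
  gu_sum : forall (I : Type) (A : I -> Type),
    U I -> (forall i, U (A i)) -> U {i : I & A i}
}.

Definition has_infinite_set (U : Type -> Prop) : Prop :=
  exists2 A : Type, U A & infinite_set [set: A]%classic.

Section Universe.
Variables (U : Type -> Prop) (hU : grothendieck_universe U).

Lemma gu_prod (A B : Type) : U A -> U B -> U (A * B)%type.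
Proof.
move=> UA UB; have := gu_sum hU UA (fun=> UB).
apply: (gu_inj hU (f := fun p : A * B => existT (fun=> B) p.1 p.2)).
by move=> [a b] [a' b'] /(congr1 (fun p : {_ : A & B} => (projT1 p, projT2 p))).
Qed.

Lemma gu_nat : has_infinite_set U -> U nat.
Proof.
move=> [A UA /infiniteP/card_leP[f]].
apply: (gu_inj hU (f := fun n : nat => val (f (to_setT n)))) => // x y /val_inj e.
by have /(congr1 val) := 'inj_f (mem_set I) (mem_set I) e.
Qed.

Lemma gu_seq (A : Type) : has_infinite_set U -> U A -> U (seq A).
Proof.
move=> /gu_nat Unat UA.
have Utuple n : U (n.-tuple A).
  elim: n => [|n IHn].
    apply: (gu_inj hU (f := fun=> true) _ (gu_pair hU)) => s t _.
    by rewrite (tuple0 s) (tuple0 t).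
  have := gu_prod UA IHn.
  apply: (gu_inj hU (f := fun s : n.+1.-tuple A => (thead s, [tuple of behead s]))).
  move=> s t /(congr1 (fun p : A * n.-tuple A => p.1 :: p.2)) /= e.
  by rewrite (tuple_eta s) (tuple_eta t); apply: val_inj.
have := gu_sum hU Unat Utuple.
apply: (gu_inj hU (f := fun s => existT (fun n => n.-tuple A) (size s) (in_tuple s))).
by move=> s t /(congr1 (fun p => tval (projT2 p))).
Qed.

End Universe.

Record gmodule (G : groupType) := GModule {
  gmod_sort :> zmodType;
  gact : G -> gmod_sort -> gmod_sort;
  gactD : forall g, {morph gact g : m n / (m + n)%R};
  gact1 : forall m, gact 1 m = m;
  gactM : forall g h m, gact (g * h) m = gact g (gact h m)
}.

Section Cochains.
Variables (G : groupType) (M : gmodule G).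

(** An element [(g_{n-1}, ..., g_0)] of [G^n] is the function [i |-> g_i]. *)
Definition gpow (n : nat) : Type := {ffun 'I_n -> G}.

Definition gvec n (t : n.-tuple G) : gpow n := [ffun i => tnth t (rev_ord i)].

Definition cochain (n : nat) : Type := gpow n -> M.

(** [face k (g_n, ..., g_0)] is [(g_n, ..., g_1)] for [k = 0],
    [(g_n, ..., g_k g_{k-1}, ..., g_0)] for [0 < k <= n], and
    [(g_{n-1}, ..., g_0)] for [k = n + 1]. *)
Definition face n (k : nat) (g : gpow n.+1) : gpow n :=
  [ffun i : 'I_n => if i.+1 < k then g (inord i)
                    else if i.+1 == k then g (inord i.+1) * g (inord i)
                    else g (inord i.+1)].

Definition differential n (c : cochain n) : cochain n.+1 := fun g =>
  (c (face 0 g) + \sum_(1 <= k < n.+1) c (face k g) *~ (-1) ^+ k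
   + gact (g ord_max) (c (face n.+1 g)) *~ (-1) ^+ n.+1)%R.

Definition cocycle n (c : cochain n) : Prop := differential c =1 (fun=> 0%R).

Definition coboundary n : cochain n -> Prop :=
  if n is p.+1 then fun c => exists b : cochain p, c =1 differential b
  else fun c => c =1 (fun=> 0%R).

(** [cpt]: componentwise pointed. *)
Definition cpt n (c : cochain n) : Prop :=
  forall g : gpow n, (exists i, g i = 1) -> c g = 0%R.

Definition cocycles (n : nat) : Type := {c : cochain n | cocycle c}.

Definition cocycles_cpt (n : nat) : Type := {c : cochain n | cpt c /\ cocycle c}.

(** The class of [z] for [cohomologous] (resp. [cohomologous_cpt]) is the coset
    [z + B^n(G, M)] (resp. [z + B^n_cpt(G, M)]). *)
Definition cohomologous n (z z' : cocycles n) : Prop :=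
  coboundary (proj1_sig z' \- proj1_sig z)%R.

Definition cohomologous_cpt n (z z' : cocycles_cpt n) : Prop :=
  let b := (proj1_sig z' \- proj1_sig z)%R in cpt b /\ coboundary b.

Definition cohomology (n : nat) : Type := quotient_set (@cohomologous n).

Definition cohomology_cpt (n : nat) : Type := quotient_set (@cohomologous_cpt n).

Lemma gact0 (g : G) : gact g 0%R = 0%R :> M.
Proof. by apply: (addrI (gact g 0%R)); rewrite -gactD !addr0. Qed.

Lemma gactN (g : G) (m : M) : gact g (- m)%R = (- gact g m)%R.
Proof. by apply: (addrI (gact g m)); rewrite -gactD !subrr gact0. Qed.

Lemma zero_cocycle n : cocycle (fun _ : gpow n => 0%R : M).
Proof.
move=> g; rewrite /differential gact0 mul0rz big1 ?addr0 // => i _.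
by rewrite mul0rz.
Qed.

Definition cocycles_cpt0 n : cocycles_cpt n := exist _ (fun=> 0%R) (conj (fun _ _ => erefl) (@zero_cocycle n)).

Definition cohomology_cpt0 n : cohomology_cpt n := class_of (@cohomologous_cpt n) (cocycles_cpt0 n).

End Cochains.

Record crossed_module := CrossedModule {
  Gp : groupType;
  Mp : groupType;
  xact : Gp -> Mp -> Mp;
  xactD : forall g, {morph xact g : m n / m * n};
  xact1 : forall m, xact 1 m = m;
  xactM : forall g h m, xact (g * h) m = xact g (xact h m);
  xmu : group_hom Mp Gp;
  xmu_act : forall g m, xmu (xact g m) = g * xmu m * g^-1;
  xpeiffer : forall n m, xact (xmu n) m = n * m * n^-1
}.

Arguments xmu : clear implicits.

Record crossed_module_morphism (V W : crossed_module) := CrossedModuleMorphism {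
  Gp_mor : group_hom (Gp V) (Gp W);
  Mp_mor : group_hom (Mp V) (Mp W);
  mor_mu : forall m, xmu W (Mp_mor m) = Gp_mor (xmu V m);
  mor_act : forall g m, Mp_mor (xact g m) = xact (Gp_mor g) (Mp_mor m)
}.

Section Extensions.
Variables (G : groupType) (M : gmodule G).

Notation Mgrp := (GRing.to_multiplicative M).

Record extension := Extension {
  ext_xmod :> crossed_module;
  iota : group_hom Mgrp (Mp ext_xmod);
  ext_pi : group_hom (Gp ext_xmod) G;
  iota_inj : injective iota;
  ext_pi_surj : forall g, exists e, ext_pi e = g;
  exact_Mp : forall m, xmu ext_xmod m = 1 <-> exists a, iota a = m;
  exact_Gp : forall e, ext_pi e = 1 <-> exists m, xmu ext_xmod m = e;
  act_iota : forall (e : Gp ext_xmod) (a : M),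
    xact e (iota a) = iota (gact (ext_pi e) a)
}.

Definition extension_equivalence (E E' : extension)
    (phi : crossed_module_morphism E E') : Prop :=
  (forall a, Mp_mor phi (iota E a) = iota E' a) /\
  (forall e, ext_pi E' (Gp_mor phi e) = ext_pi E e).

Definition extension_in (U : Type -> Prop) : Type :=
  {E : extension | U (Gp E) /\ U (Mp E)}.

Definition ext_related U (E E' : extension_in U) : Prop :=
  exists phi, @extension_equivalence (proj1_sig E) (proj1_sig E') phi.

Definition ext_approx U : extension_in U -> extension_in U -> Prop :=
  clos_refl_sym_trans _ (@ext_related U).

Definition Ext2 U : Type := quotient_set (@ext_approx U).

Definition trivial_mu : group_hom Mgrp G := monoid.one_fun G.

Definition trivial_xmod : crossed_module.
Proof.
refine (@CrossedModule G Mgrp (@gact G M) (@gactD G M) (@gact1 G M) (@gactM G M)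
          trivial_mu _ _).
- by move=> g m /=; rewrite mulg1 mulgV.
- move=> n m /=; rewrite gact1; apply: (mulIg n); rewrite mulgVK.
  exact: addrC.
Defined.

Definition trivial_extension : extension.
Proof.
refine (@Extension trivial_xmod idfun idfun _ _ _ _ _).
- by [].
- by move=> g; exists g.
- by move=> m; split=> // _; exists m.
- by move=> e; split=> [e1|[m <-]//]; exists 1; symmetry.
- by [].
Defined.

Definition trivial_extension_in U (UG : U (G : Type)) (UM : U (M : Type)) :
  extension_in U := exist _ trivial_extension (conj UG UM).

End Extensions.

Section PointedFreeGroup.
Variables (X : choiceType) (x0 : X).

(** The letter [(x, true)] stands for [x], and [(x, false)] for its inverse. *)
Definition letter : Type := (X * bool)%type.

Definition letter_inv (a : letter) : letter := (a.1, ~~ a.2).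

Definition reduced (w : seq letter) : bool :=
  all (fun a => a.1 != x0) w && sorted (fun a b => b != letter_inv a) w.

Record pointed_free := PointedFree {
  word : seq letter;
  word_reduced : reduced word
}.

HB.instance Definition _ := [isSub for word].
HB.instance Definition _ := [Choice of pointed_free by <:].

(** The reduced form of [a :: w], for a reduced word [w]. *)
Definition push (a : letter) (w : seq letter) : seq letter :=
  if a.1 == x0 then w
  else if w is b :: w' then if b == letter_inv a then w' else a :: w
  else [:: a].

Lemma letter_invK : involutive letter_inv.
Proof. by case=> x b; rewrite /letter_inv /= negbK. Qed.

Lemma reduced_cons a w : reduced (a :: w) =
  [&& a.1 != x0, (if w is b :: _ then b != letter_inv a else true) & reduced w].
Proof.
rewrite /reduced /=; case: w => [|b w] /=; first by rewrite !andbT.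
by case: (a.1 != x0); case: (b.1 != x0); case: (all _ _); case: (b != _);
   rewrite ?andbF.
Qed.

Lemma push_reduced a w : reduced w -> reduced (push a w).
Proof.
rewrite /push; case: eqP => // /eqP a0; case: w => [|b w].
  by rewrite reduced_cons a0.
case: eqP => [_|/eqP ba]; first by rewrite reduced_cons => /and3P[].
by move=> rw; rewrite reduced_cons a0 ba.
Qed.

Lemma push_cons a w : reduced (a :: w) -> push a w = a :: w.
Proof.
rewrite reduced_cons /push => /and3P[/negPf-> h _].
by case: w h => // b w /negPf->.
Qed.

Lemma pushK a w : reduced w -> push a (push (letter_inv a) w) = w.
Proof.
rewrite {2}/push [(letter_inv a).1]/=; case: eqP => [a0 _|/eqP/negPf a0].
  by rewrite /push a0 eqxx.
case: w => [|b w] rw; first by rewrite /push a0 eqxx.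
rewrite letter_invK; case: eqP => [ba|_]; last by rewrite /push a0 eqxx.
by subst b; rewrite push_cons.
Qed.

Definition word_mul (u v : seq letter) : seq letter := foldr push v u.

Definition word_inv (u : seq letter) : seq letter := rev (map letter_inv u).

Lemma word_mul_reduced u v : reduced v -> reduced (word_mul u v).
Proof. by move=> rv; elim: u => //= a u; apply: push_reduced. Qed.

Lemma word_mulr1 u : reduced u -> word_mul u [::] = u.
Proof.
elim: u => //= a u IHu rau; have:= rau; rewrite reduced_cons => /and3P[_ _ ru].
by rewrite IHu // push_cons.
Qed.

Lemma push_mul a u v : reduced u -> reduced v ->
  word_mul (push a u) v = push a (word_mul u v).
Proof.
move=> ru rv; rewrite {1}/push; case: eqP => [a0|_].
  by rewrite /push a0 eqxx.
case: u ru => // b u _; case: eqP => // -> /=.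
by rewrite pushK // word_mul_reduced.
Qed.

Lemma word_mulA u v w : reduced v -> reduced w ->
  word_mul u (word_mul v w) = word_mul (word_mul u v) w.
Proof.
move=> rv rw; elim: u => //= a u ->.
by rewrite push_mul // word_mul_reduced.
Qed.

Lemma word_inv_mul u v : reduced v -> word_mul (word_inv u) (word_mul u v) = v.
Proof.
move=> rv; elim: u => //= a u IHu.
rewrite /word_inv map_cons rev_cons {1}/word_mul foldr_rcons.
by rewrite -{2}[a]letter_invK pushK ?word_mul_reduced.
Qed.

Lemma word_inv_reduced u : reduced u -> reduced (word_inv u).
Proof.
rewrite /reduced /word_inv => /andP[u0 us]; rewrite all_rev all_map.
rewrite u0 rev_sorted sorted_map /=; apply: sub_sorted us => a b ba.
by apply: contra ba => /eqP->; rewrite letter_invK.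
Qed.

Definition pf_one : pointed_free := @PointedFree [::] isT.

Definition pf_mul (u v : pointed_free) : pointed_free :=
  PointedFree (word_mul_reduced (word u) (word_reduced v)).

Definition pf_inv (u : pointed_free) : pointed_free :=
  PointedFree (word_inv_reduced (word_reduced u)).

Lemma pf_mulA : associative pf_mul.
Proof. by move=> u v w; apply: val_inj; apply: word_mulA; apply: word_reduced. Qed.

Lemma pf_mul1 : left_id pf_one pf_mul.
Proof. by move=> u; apply: val_inj. Qed.

Lemma pf_mulr1 : right_id pf_one pf_mul.
Proof. by move=> u; apply: val_inj; apply: word_mulr1; apply: word_reduced. Qed.

Lemma pf_mulV : left_inverse pf_one pf_inv pf_mul.
Proof.
move=> u; apply: val_inj; rewrite /= -{2}[word u]word_mulr1 ?word_reduced //.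
exact: word_inv_mul.
Qed.

Lemma pf_mulrV : right_inverse pf_one pf_inv pf_mul.
Proof.
by move=> u; rewrite -[LHS]pf_mul1 -{1}(pf_mulV (pf_inv u)) -pf_mulA
  [pf_mul _ (pf_mul u _)]pf_mulA pf_mulV pf_mul1 pf_mulV.
Qed.

HB.instance Definition _ := isGroup.Build pointed_free
  pf_mulA pf_mul1 pf_mulr1 pf_mulV pf_mulrV.

Definition pf_gen (x : X) : pointed_free :=
  PointedFree (push_reduced (x, true) (isT : reduced [::])).

Lemma pf_gen0 : pf_gen x0 = 1.
Proof. by apply: val_inj; rewrite /= /push eqxx. Qed.

Lemma pf_genV x : val (pf_gen x)^-1 = push (x, false) [::].
Proof.
by rewrite /= /word_inv /push /=; case: eqP.
Qed.

Section Lift.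
Variables (K : groupType) (f : X -> K).

Definition letter_val (a : letter) : K := if a.2 then f a.1 else (f a.1)^-1.

Definition word_val (w : seq letter) : K := \prod_(a <- w) letter_val a.

Definition pf_lift (w : pointed_free) : K := word_val (word w).

Hypothesis f0 : f x0 = 1.

Lemma word_val_push a w : word_val (push a w) = letter_val a * word_val w.
Proof.
rewrite /push; case: eqP => [a0|_].
  by rewrite /letter_val a0 f0 invg1 if_same mul1g.
case: w => [|b w]; first by rewrite /word_val big_seq1 big_nil mulg1.
case: eqP => [->|_]; rewrite /word_val !big_cons //.
by rewrite mulgA /letter_val /=; case: a.2; rewrite /= ?mulgV ?mulVg mul1g.
Qed.

Lemma word_val_mul u v : word_val (word_mul u v) = word_val u * word_val v.
Proof.
elim: u => [|a u IHu] /=; first by rewrite /word_val big_nil mul1g.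
by rewrite word_val_push IHu mulgA /word_val big_cons.
Qed.

Lemma pf_lift_is_hom : monoid.monoid_morphism pf_lift.
Proof.
split; first by rewrite /pf_lift /word_val big_nil.
by move=> u v; apply: word_val_mul.
Qed.

Lemma pf_lift_gen x : pf_lift (pf_gen x) = f x.
Proof. by rewrite /pf_lift word_val_push /word_val big_nil mulg1. Qed.

End Lift.

Lemma pf_ind (P : pointed_free -> Prop) : P 1 ->
  (forall x w, P w -> P (pf_gen x * w)) ->
  (forall x w, P w -> P ((pf_gen x)^-1 * w)) -> forall w, P w.
Proof.
move=> P1 Pg Pv [w]; elim: w => [|[x b] w IHw] raw.
  by rewrite (_ : PointedFree _ = 1) //; apply: val_inj.
have := raw; rewrite reduced_cons => /and3P[/negPf /= x0n _ rw].
rewrite (_ : PointedFree raw =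
  (if b then pf_gen x else (pf_gen x)^-1) * PointedFree rw).
  by case: b {raw} => //; [apply: Pg|apply: Pv].
apply: val_inj; rewrite [val _]/= -(push_cons raw).
by case: {raw} b; rewrite /= /word_inv [push _ [::]]/push /= x0n.
Qed.

(** With [pf_lift_is_hom] and [pf_lift_gen]: [pointed_free] is free on the
    pointed set [X], with basis [pf_gen]. *)
Lemma pf_lift_unique (K : groupType) (f f' : group_hom pointed_free K) :
  (forall x, f (pf_gen x) = f' (pf_gen x)) -> f =1 f'.
Proof.
move=> ff'; apply: pf_ind => [|x w|x w]; first by rewrite !gmulf1.
  by rewrite !gmulfM ff' => ->.
by rewrite !gmulfM !gmulfV ff' => ->.
Qed.

Lemma gu_pointed_free (U : Type -> Prop) : grothendieck_universe U ->
  has_infinite_set U -> U (X : Type) -> U pointed_free.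
Proof.
move=> hU Uinf UX; apply: (gu_inj hU (@val_inj _ _ pointed_free)).
by apply: gu_seq => //; apply: gu_prod => //; apply: gu_pair.
Qed.

End PointedFreeGroup.

Section Kernel.
Variables (A B : groupType) (f : group_hom A B).

Definition ker_pred : pred A := fun x => f x == 1.

Record kernel := Kernel { ker_val : A; ker_valP : ker_pred ker_val }.

HB.instance Definition _ := [isSub for ker_val].
HB.instance Definition _ := [Choice of kernel by <:].

Lemma ker_group_closed : group_closed ker_pred.
Proof.
split=> [|x y]; rewrite !unfold_in; first by rewrite gmulf1.
by move=> /eqP fx /eqP fy; rewrite gmulfF fx fy invg1 mulg1.
Qed.

HB.instance Definition _ :=
  SubChoice_isSubGroup.Build A ker_pred kernel ker_group_closed.

Lemma ker_conjP (x : A) (r : kernel) : ker_pred (x * val r * x^-1).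
Proof.
by rewrite /ker_pred !gmulfM (eqP (ker_valP r)) mulg1 -gmulfM mulgV gmulf1.
Qed.

Definition ker_conj (x : A) (r : kernel) : kernel := Kernel (ker_conjP x r).

End Kernel.

Section Differential3.
Variables (G : groupType) (M : gmodule G).

Lemma differential3E (c : cochain M 3) (v : gpow G 4) :
  let g3 := v (inord 3%N) in let g2 := v (inord 2%N) in
  let g1 := v (inord 1%N) in let g0 := v (inord 0%N) in
  differential c v =
    (c (gvec [tuple g3; g2; g1]) - c (gvec [tuple g3; g2; g1 * g0]%g)
     + c (gvec [tuple g3; g2 * g1; g0]%g) - c (gvec [tuple g3 * g2; g1; g0]%g)
     + gact g3 (c (gvec [tuple g2; g1; g0])))%R.
Proof.
have E (s t : gpow G 3) : s (inord 0%N) = t (inord 0%N) -> s (inord 1%N) = t (inord 1%N) ->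
    s (inord 2%N) = t (inord 2%N) -> s = t.
  move=> e0 e1 e2; apply/ffunP => -[[|[|[|//]]] i3].
  - by rewrite (_ : Ordinal i3 = inord 0%N) //; apply: val_inj; rewrite /= inordK.
  - by rewrite (_ : Ordinal i3 = inord 1%N) //; apply: val_inj; rewrite /= inordK.
  - by rewrite (_ : Ordinal i3 = inord 2%N) //; apply: val_inj; rewrite /= inordK.
rewrite /differential 3?big_ltn // big_geq //=.
rewrite (_ : ord_max = inord 3%N :> 'I_4); last by apply: val_inj; rewrite /= inordK.
rewrite !exprS expr0 !mulN1r !mulrNz !opprK !mulr1z !addr0 !addrA.
by do !congr (_ + _)%R; rewrite ?opprK; do ?[congr (- _)%R]; do ?[congr (gact _ _)];
  congr (c _); apply: E; rewrite !ffunE !(tnth_nth 1) /= !inordK.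
Qed.

Lemma cocycle3E (c : cochain M 3) : cocycle c <-> forall l k h g : G,
  (c (gvec [tuple l; k; h]) - c (gvec [tuple l; k; h * g]%g)
     + c (gvec [tuple l; k * h; g]%g) - c (gvec [tuple l * k; h; g]%g)
     + gact l (c (gvec [tuple k; h; g])))%R = 0%R.
Proof.
split=> [cc l k h g|cc v]; last by rewrite differential3E cc.
have := cc (gvec [tuple l; k; h; g]); rewrite differential3E.
by rewrite !ffunE !(tnth_nth 1) /= !inordK.
Qed.

End Differential3.

Section StandardExtension.
Variables (G : groupType) (M : gmodule G) (z : cocycles_cpt M 3).

Notation Mgrp := (GRing.to_multiplicative M).

Definition zval (k h g : G) : M := proj1_sig z (gvec [tuple k; h; g]).

Lemma zval_cpt k h g : k = 1 \/ h = 1 \/ g = 1 -> zval k h g = 0%R.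
Proof.
have [cz _] := proj2_sig z; move=> e1; apply: cz.
case: e1 => [->|[->|->]]; [exists (inord 2%N)|exists (inord 1%N)|exists (inord 0%N)];
  by rewrite ffunE (tnth_nth 1) /= inordK.
Qed.

Lemma zval_cocycle l k h g : (zval l k h - zval l k (h * g)%g
  + zval l (k * h)%g g - zval (l * k)%g h g + gact l (zval k h g))%R = 0%R.
Proof. by have [_ cz] := proj2_sig z; apply: (cocycle3E _).1. Qed.

Definition std_free : groupType := pointed_free (1 : G).

Definition std_gen (g : G) : std_free := pf_gen 1 g.

Definition std_pi : std_free -> G := pf_lift id.

HB.instance Definition _ :=
  monoid.isUMagmaMorphism.Build std_free G std_pi (pf_lift_is_hom erefl).

Lemma std_pi_gen g : std_pi (std_gen g) = g.
Proof. exact: pf_lift_gen. Qed.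

Lemma std_piM u v : std_pi (u * v) = std_pi u * std_pi v.
Proof. exact: gmulfM. Qed.

Lemma std_piV u : std_pi u^-1 = (std_pi u)^-1.
Proof. exact: gmulfV. Qed.

Definition std_Mp : groupType := (Mgrp * kernel std_pi)%type.

(** The homomorphism [std_phi k : Ker pi -> M] maps [std_z2 h g] to
    [- z k h g].  It is obtained without a basis of [Ker pi]: since [z] is
    componentwise pointed, the free group acts from the right on the set [M * G]
    by [(m, x) * std_gen g = (m - z k x g, x * g)], and [fox k x w] is the first
    component of [(0, x) * w]. *)
Definition fox1 (k x : G) (a : letter G) : M :=
  if a.2 then (- zval k x a.1)%R else zval k (x * a.1^-1) a.1.

Fixpoint fox (k x : G) (w : seq (letter G)) : M :=
  if w is a :: w' then (fox1 k x a + fox k (x * letter_val id a)%g w')%R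
  else 0%R.

Definition std_phi (k : G) (r : kernel std_pi) : M := fox k 1 (word (val r)).

Lemma fox1V k x a :
  (fox1 k x a + fox1 k (x * letter_val id a)%g (letter_inv a))%R = 0%R.
Proof.
by case: a => g []; rewrite /fox1 /letter_val /= ?mulgK ?addNr ?subrr.
Qed.

Lemma fox_push k x a w :
  fox k x (push 1 a w) = (fox1 k x a + fox k (x * letter_val id a)%g w)%R.
Proof.
rewrite /push; case: eqP => [a1|_].
  rewrite /fox1 /letter_val a1 invg1 if_same mulg1 !zval_cpt ?oppr0 ?if_same ?add0r //;
  by right; right.
case: w => [|b w] //; case: eqP => // -> /=.
rewrite addrA fox1V add0r; congr (fox k _ w).
by rewrite /letter_val /=; case: a.2; rewrite /= ?mulgK ?mulgVK.
Qed.

Lemma fox_mul k x u v :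
  fox k x (word_mul 1 u v) = (fox k x u + fox k (x * word_val id u)%g v)%R.
Proof.
elim: u x => [|a u IHu] x /=; first by rewrite /word_val big_nil mulg1 add0r.
by rewrite fox_push IHu addrA /word_val big_cons mulgA.
Qed.

Lemma foxM k x (u v : std_free) :
  fox k x (word (u * v)) = (fox k x (word u) + fox k (x * std_pi u)%g (word v))%R.
Proof. exact: fox_mul. Qed.

Lemma fox1_eq0 x w : fox 1 x w = 0%R.
Proof.
elim: w x => //= a w IHw x; rewrite IHw /fox1.
by rewrite !zval_cpt ?oppr0 ?if_same ?addr0 //; left.
Qed.

Lemma fox_cocycle h g x w :
  (gact h (fox g x w) + fox h (g * x)%g w - fox (h * g)%g x w)%R =
  (zval h g x - zval h g (x * word_val id w)%g)%R.
Proof.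
elim: w x => [|a w IHw] x /=.
  by rewrite gact0 !addr0 subr0 /word_val big_nil mulg1 subrr.
have fE : (gact h (fox1 g x a) + fox1 h (g * x)%g a - fox1 (h * g)%g x a)%R =
    (zval h g x - zval h g (x * letter_val id a)%g)%R.
  case: a => y [] /=; rewrite /fox1 /letter_val /=.
    rewrite gactN opprK.
    have /eqP := zval_cocycle h g x y; rewrite -!addrA addrA addr_eq0 => /eqP->.
    by rewrite !opprD opprK addrC addrA addrAC -!addrA addrCA addrC -addrA.
  have /eqP := zval_cocycle h g (x * y^-1) y; rewrite mulgVK mulgA.
  rewrite -!addrA addrA addrC addr_eq0 opprB => /eqP<-.
  by rewrite addrC -addrA.
have := IHw (x * letter_val id a); rewrite mulgA => e.
rewrite gactD /word_val big_cons -/(word_val _ _) mulgA.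
transitivity ((zval h g x - zval h g (x * letter_val id a)%g) +
  (zval h g (x * letter_val id a)%g - zval h g (x * letter_val id a * word_val id w)%g))%R.
  rewrite -fE -e opprD !addrA.
  by rewrite (ACl (1*3*5*2*4*6))%AC.
by rewrite addrA subrK.
Qed.

Lemma std_pi_ker (r : kernel std_pi) : word_val id (word (val r)) = 1.
Proof. exact: eqP (ker_valP r). Qed.

Lemma std_phiD k (q r : kernel std_pi) :
  std_phi k (q * r) = (std_phi k q + std_phi k r)%R.
Proof. by rewrite /std_phi fox_mul std_pi_ker mulg1. Qed.

Lemma std_phi1 (r : kernel std_pi) : std_phi 1 r = 0%R.
Proof. exact: fox1_eq0. Qed.

Lemma std_phiM h (w : std_free) (r : kernel std_pi) :
  std_phi (h * std_pi w) r =
  (gact h (std_phi (std_pi w) r) + std_phi h (ker_conj w r))%R.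
Proof.
have piM u v : word_val id (word_mul 1 u v) = word_val id u * word_val id v :> G.
  exact: word_val_mul.
have := fox_cocycle h (std_pi w) 1 (word (val r)).
rewrite std_pi_ker !mulg1 subrr => /eqP; rewrite subr_eq0 => /eqP e.
rewrite /std_phi -{}e; congr (_ + _)%R; rewrite /ker_conj /=.
rewrite !fox_mul piM std_pi_ker !mulg1 !mul1g.
have := fox_mul h 1 (word w) (word w^-1); rewrite mul1g.
have -> : word_mul 1 (word w) (word w^-1) = [::] :> seq (letter G).
  by have /(congr1 (@word _ _)) := mulgV w.
by move=> /= e; rewrite addrAC -e add0r.
Qed.

Definition std_act (w : std_free) (p : std_Mp) : std_Mp :=
  ((gact (std_pi w) (p.1 : M) + std_phi (std_pi w) p.2)%R, ker_conj w p.2).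

Definition std_mu (p : std_Mp) : std_free := val p.2.

Lemma std_mu_is_hom : monoid.monoid_morphism std_mu.
Proof. by split=> // p q; rewrite /std_mu /= valM. Qed.

HB.instance Definition _ :=
  monoid.isUMagmaMorphism.Build std_Mp std_free std_mu std_mu_is_hom.

Definition std_iota (m : Mgrp) : std_Mp := (m, 1).

Lemma std_iota_is_hom : monoid.monoid_morphism std_iota.
Proof. by split=> // m n; congr (_, _); rewrite mulg1. Qed.

HB.instance Definition _ :=
  monoid.isUMagmaMorphism.Build Mgrp std_Mp std_iota std_iota_is_hom.

Lemma std_actD w : {morph std_act w : p q / p * q}.
Proof.
move=> [m q] [n r]; congr (_, _); rewrite /=.
  by rewrite (gactD (std_pi w) m n) std_phiD; apply: addrACA.
by apply: val_inj; rewrite valM /= !mulgA mulgVK.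
Qed.

Lemma std_act1 p : std_act 1 p = p.
Proof.
case: p => m r; rewrite /std_act gmulf1 /= gact1 std_phi1 addr0.
by congr (_, _); apply: val_inj; rewrite /= mul1g invg1 mulg1.
Qed.

Lemma std_actM w w' p : std_act (w * w') p = std_act w (std_act w' p).
Proof.
case: p => m r; rewrite /std_act gmulfM /= gactM gactD -addrA -std_phiM.
by congr (_, _); apply: val_inj; rewrite /= invgM !mulgA.
Qed.

Lemma std_mu_act w p : std_mu (std_act w p) = w * std_mu p * w^-1.
Proof. by []. Qed.

Lemma std_peiffer p q : std_act (std_mu p) q = p * q * p^-1.
Proof.
case: p q => [m r] [n q]; rewrite /std_act /std_mu /=.
rewrite (_ : std_pi (ker_val r) = 1); last exact: eqP (ker_valP r).
rewrite gact1 std_phi1 addr0; congr (_, _); last first.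
  by apply: val_inj; rewrite !valM gmulfV.
by apply: (mulIg (m : Mgrp)); rewrite mulgVK; apply: addrC.
Qed.

Definition std_xmod : crossed_module :=
  CrossedModule std_actD std_act1 std_actM std_mu_act std_peiffer.

Definition std_extension : extension M.
Proof.
refine (@Extension G M std_xmod std_iota std_pi _ _ _ _ _).
- by move=> m n [].
- by move=> g; exists (std_gen g); apply: std_pi_gen.
- move=> [m r]; split=> [r1|[a [_ <-]] //].
  by exists m; congr (_, _); apply: val_inj.
- move=> w; split=> [/eqP w1|[p <-]]; first by exists (1, Kernel w1).
  exact: eqP (ker_valP p.2).
- move=> w m; congr (_, _); last by apply: val_inj; rewrite /= mulg1 mulgV.
  by rewrite /std_phi /= addr0.
Defined.

(** [std_act] is the unique action by automorphisms with the prescribed values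
    on [(m, 1)] and [(0, z^2(h, g))]: see [std_act_iota], [std_act_z2] and
    [std_act_unique]. *)

Lemma std_z2_ker h g : ker_pred std_pi (std_gen h * std_gen g * (std_gen (h * g))^-1).
Proof.
by rewrite /ker_pred !gmulfM gmulfV /= !std_pi_gen mulgV.
Qed.

Definition std_z2 (h g : G) : kernel std_pi := Kernel (std_z2_ker h g).

Lemma std_act_iota k (m : M) :
  std_act (std_gen k) ((m : Mgrp), 1) = ((gact k m : Mgrp), 1).
Proof.
congr (_, _); last by apply: val_inj; rewrite /= mulg1 mulgV.
by rewrite /std_phi /= addr0 std_pi_gen.
Qed.

Lemma std_act_z2 k h g : std_act (std_gen k) ((0%R : M), std_z2 h g) =
  ((- zval k h g)%R, ker_conj (std_gen k) (std_z2 h g)).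
Proof.
congr (_, _); rewrite /= gact0 add0r std_pi_gen /std_phi.
have e x y : fox k x (word (std_gen y)) = (- zval k x y)%R.
  by rewrite /= fox_push /= addr0.
have eV x y : fox k x (word (std_gen y)^-1) = zval k (x * y^-1) y.
  by rewrite [word _]pf_genV fox_push /= addr0.
rewrite [val _]/= !foxM gmulfM /= !std_pi_gen eV !e !mul1g mulgV.
have z1 y : zval k 1 y = 0%R by apply: zval_cpt; right; left.
by rewrite !z1 oppr0 add0r addr0.
Qed.

Lemma std_ker_ind (P : kernel std_pi -> Prop) : P 1 ->
  (forall q r, P q -> P r -> P (q * r)) -> (forall r, P r -> P r^-1) ->
  (forall h g, P (std_z2 h g)) -> forall r, P r.
Proof.
move=> P1 PM PV Pz r.
have Pw (w : std_free) x :
    exists2 q : kernel std_pi, P q & std_gen x * w = val q * std_gen (x * std_pi w).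
  move: w x; apply: pf_ind => [x|y w IHw x|y w IHw x].
  - by exists 1 => //; rewrite !gmulf1 !mulg1 mul1g.
  - have [q Pq qE] := IHw (x * y); exists (std_z2 x y * q); first exact: PM.
    rewrite std_piM [std_pi (pf_gen _ _)]std_pi_gen valM mulgA.
    by rewrite [x * (y * _)]mulgA -[RHS]mulgA -qE [val _]/= !mulgA mulgVK.
  - have [q Pq qE] := IHw (x * y^-1); exists ((std_z2 (x * y^-1) y)^-1 * q).
      by apply: PM => //; apply: PV.
    rewrite std_piM std_piV [std_pi (pf_gen _ _)]std_pi_gen valM -[RHS]mulgA.
    have -> : val (std_z2 (x * y^-1) y)^-1 = (val (std_z2 (x * y^-1) y))^-1.
      exact: gmulfV.
    rewrite [x * (y^-1 * _)]mulgA -qE [val _]/= mulgVK !invgM invgK.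
    by rewrite -!mulgA; congr (_ * _); rewrite mulKg.
have [q Pq] := Pw (val r) 1; rewrite [std_gen 1]pf_gen0 mul1g.
rewrite (_ : std_pi (val r) = 1); last exact: eqP (ker_valP r).
by rewrite mulg1 [std_gen 1]pf_gen0 mulg1 => /val_inj->.
Qed.

Lemma std_act_unique (act : std_free -> std_Mp -> std_Mp) :
  (forall w, {morph act w : p q / p * q}) -> (forall p, act 1 p = p) ->
  (forall w w' p, act (w * w') p = act w (act w' p)) ->
  (forall k (m : M), act (std_gen k) ((m : Mgrp), 1) = ((gact k m : Mgrp), 1)) ->
  (forall k h g, act (std_gen k) ((0%R : M), std_z2 h g) =
     ((- zval k h g)%R, ker_conj (std_gen k) (std_z2 h g))) ->
  forall w p, act w p = std_act w p.
Proof.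
move=> aD a1 aM ai az.
have mor1 (f : std_Mp -> std_Mp) : {morph f : p q / p * q} -> f 1 = 1.
  by move=> fM; apply: (mulgI (f 1)); rewrite -fM !mulg1.
have morV (f : std_Mp -> std_Mp) : {morph f : p q / p * q} -> {morph f : p / p^-1}.
  by move=> fM p; apply: (mulgI (f p)); rewrite -fM !mulgV mor1.
have agen k p : act (std_gen k) p = std_act (std_gen k) p.
  case: p => m r; have -> : (m, r) = (m, 1) * (1, r) :> std_Mp.
    by congr (_, _); rewrite ?mulg1 ?mul1g.
  rewrite aD std_actD ai std_act_iota; congr (_ * _).
  elim/std_ker_ind: r => [|q r aq ar|r ar|h g].
  - by rewrite (mor1 _ (aD _)) (mor1 _ (std_actD _)).
  - have -> : (1, q * r) = (1, q) * (1, r) :> std_Mp by congr (_, _); rewrite mulg1.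
    by rewrite aD std_actD aq ar.
  - have -> : (1, r^-1) = (1, r)^-1 :> std_Mp by congr (_, _); rewrite invg1.
    by rewrite (morV _ (aD _)) (morV _ (std_actD _)) ar.
  - by rewrite az -std_act_z2.
apply: pf_ind => [p|x w IHw p|x w IHw p]; first by rewrite a1 std_act1.
  by rewrite aM std_actM IHw agen.
rewrite aM std_actM IHw; move: (std_act w p) => {}p.
rewrite -{1}[p](std_act1 p) -(mulgV (std_gen x)) std_actM -agen -aM.
by rewrite mulVg a1.
Qed.

Lemma std_extension_in (U : Type -> Prop) : grothendieck_universe U ->
  has_infinite_set U -> U (G : Type) -> U (M : Type) ->
  U (Gp std_extension) /\ U (Mp std_extension).
Proof.
move=> hU Uinf UG UM; have UF : U std_free by apply: gu_pointed_free.
split=> //; apply: gu_prod => //.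
exact: gu_inj hU _ _ _ (@val_inj _ _ (kernel std_pi)) UF.
Qed.

End StandardExtension.

Section LiftingSystems.
Variables (G : groupType) (M : gmodule G) (E : extension M).

Record lifting_system := LiftingSystem {
  lift2 : G -> G -> Mp E;
  lift1 : G -> Gp E;
  lift1_pointed : lift1 1 = 1;
  lift1K : forall g, ext_pi E (lift1 g) = g;
  lift2_cpt : forall h g, h = 1 \/ g = 1 -> lift2 h g = 1;
  mu_lift2 : forall h g,
    xmu E (lift2 h g) = lift1 h * lift1 g * (lift1 (h * g))^-1
}.

Lemma lifting_system_exists : exists s : lifting_system, True.
Proof.
pose l1 g := if g == 1 then 1 else projT1 (cid (ext_pi_surj E g)).
have l1K g : ext_pi E (l1 g) = g.
  by rewrite /l1; case: eqP => [->|_]; [rewrite gmulf1|case: cid].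
have ex2 h g : exists m, xmu E m = l1 h * l1 g * (l1 (h * g))^-1.
  by apply/exact_Gp; rewrite !gmulfM gmulfV !l1K mulgV.
pose l2 h g := if (h == 1) || (g == 1) then 1 else projT1 (cid (ex2 h g)).
have l11 : l1 1 = 1 by rewrite /l1 eqxx.
have l2c h g : h = 1 \/ g = 1 -> l2 h g = 1.
  by rewrite /l2 => -[]->; rewrite eqxx ?orbT.
have l2mu h g : xmu E (l2 h g) = l1 h * l1 g * (l1 (h * g))^-1.
  rewrite /l2; case: eqP => [->|_] /=.
    by rewrite gmulf1 l11 !mul1g mulgV.
  case: eqP => [->|_]; last by case: cid.
  by rewrite gmulf1 l11 !mulg1 mulgV.
by exists (LiftingSystem l11 l1K l2c l2mu).
Qed.

Definition iota_inv (m : Mp E) : M := xget 0%R [set a | iota E a = m]%classic.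

Lemma iota_invK (m : Mp E) : xmu E m = 1 -> iota E (iota_inv m) = m.
Proof. by move=> /exact_Mp exm; rewrite /iota_inv; apply: (xgetPex 0%R exm). Qed.

Lemma iotaK (a : M) : iota_inv (iota E a) = a.
Proof. by apply/(@iota_inj _ _ E)/iota_invK/exact_Mp; exists a. Qed.

Variable s : lifting_system.

Definition cocycle3_val (k h g : G) : Mp E :=
  lift2 s k h * lift2 s (k * h) g * (lift2 s k (h * g))^-1
  * (xact (lift1 s k) (lift2 s h g))^-1.

Definition cocycle3_fun : cochain M 3 := fun v =>
  iota_inv (cocycle3_val (v (inord 2%N)) (v (inord 1%N)) (v (inord 0%N))).

Lemma xact_1 (e : Gp E) : xact e 1 = 1.
Proof. by apply: (mulgI (xact e 1)); rewrite -xactD !mulg1. Qed.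

Lemma xact_V (e : Gp E) m : xact e m^-1 = (xact e m)^-1.
Proof. by apply: (mulgI (xact e m)); rewrite -xactD !mulgV xact_1. Qed.

Lemma iota_central (a : M) m : iota E a * m = m * iota E a.
Proof.
apply: (mulIg (iota E a)^-1); rewrite -xpeiffer mulgK.
by rewrite (proj2 (exact_Mp _)) ?xact1 //; exists a.
Qed.

Lemma iota_cocycle3 k h g :
  iota E (iota_inv (cocycle3_val k h g)) = cocycle3_val k h g.
Proof.
apply: iota_invK; rewrite /cocycle3_val !gmulfM !gmulfV xmu_act !mu_lift2.
by rewrite !invgM !invgK !mulgA ?(mulgVK, mulgK) mulgV.
Qed.

Lemma cocycle3_fun_cpt : cpt cocycle3_fun.
Proof.
move=> v [i v1]; have fE m : m = 1 -> iota_inv m = 0%R.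
  move=> ->; rewrite -(iotaK 0%R); congr iota_inv; symmetry; exact: gmulf1.
apply: fE; rewrite /cocycle3_val.
have l2l g : lift2 s 1 g = 1 by apply: lift2_cpt; left.
have l2r h : lift2 s h 1 = 1 by apply: lift2_cpt; right.
have vE (j : nat) (j3 : j < 3) : Ordinal j3 = i -> v (inord j) = 1.
  by move=> ji; rewrite -v1 -ji; congr (v _); apply: val_inj; rewrite /= inordK.
case: i vE {v1} => [[|[|[|//]]] i3] /(_ _ _ erefl) -> .
- by rewrite mulg1 !l2r xact_1 invg1 !mulg1 mulgV.
- by rewrite mulg1 mul1g l2l l2r xact_1 invg1 mul1g mulg1 mulgV.
- by rewrite !mul1g lift1_pointed xact1 !l2l invg1 mul1g mulg1 mulgV.
Qed.

Lemma lift2_mul k h g : lift2 s k h * lift2 s (k * h) g =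
  cocycle3_val k h g * xact (lift1 s k) (lift2 s h g) * lift2 s k (h * g).
Proof. by rewrite /cocycle3_val !mulgVK. Qed.

Lemma lift2_act l k m : lift2 s l k * xact (lift1 s (l * k)) m =
  xact (lift1 s l) (xact (lift1 s k) m) * lift2 s l k.
Proof.
apply: (mulIg (lift2 s l k)^-1); rewrite mulgK -xpeiffer mu_lift2 -xactM.
by rewrite mulgVK xactM.
Qed.

Lemma cocycle3_fun_cocycle : cocycle cocycle3_fun.
Proof.
pose z k h g := iota_inv (cocycle3_val k h g).
have zE k h g : cocycle3_fun (gvec [tuple k; h; g]) = z k h g.
  by rewrite /cocycle3_fun !ffunE !(tnth_nth 1) /= !inordK.
have lE k h g : lift2 s k h * lift2 s (k * h) g =
    iota E (z k h g) * xact (lift1 s k) (lift2 s h g) * lift2 s k (h * g).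
  by rewrite lift2_mul iota_cocycle3.
apply/cocycle3E => l k h g; rewrite !{}zE.
pose w := xact (lift1 s l) (xact (lift1 s k) (lift2 s h g))
  * xact (lift1 s l) (lift2 s k (h * g)) * lift2 s l (k * h * g).
have e1 : lift2 s l k * lift2 s (l * k) h * lift2 s (l * k * h) g =
    iota E (z (l * k) h g)%g * (iota E (z l k (h * g)%g) * w).
  rewrite -[LHS]mulgA lE !mulgA -[lift2 s l k * iota E _]iota_central -!mulgA.
  congr (_ * _); rewrite [LHS]mulgA lift2_act -[LHS]mulgA lE.
  by rewrite -!mulgA [LHS]mulgA -iota_central -!mulgA.
have e2 : lift2 s l k * lift2 s (l * k) h * lift2 s (l * k * h) g =
    iota E (z l k h) * (iota E (z l (k * h)%g g) * (iota E (gact l (z k h g)) * w)).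
  rewrite lE -!mulgA; congr (_ * _); rewrite (mulgA l k h).
  rewrite -[(l * k) * h]mulgA lE !mulgA -[_ * iota E _]iota_central -!mulgA.
  congr (_ * _); rewrite /w !mulgA -xactD lE.
  by rewrite !xactD act_iota lift1K -!mulgA.
rewrite {}e2 in e1; clearbody w.
have iD a b : iota E a * iota E b = iota E (a + b)%R.
  by symmetry; exact: (gmulfM (s := iota E)).
move: e1; rewrite !mulgA => /mulIg; rewrite !iD => /iota_inj.
move: (z l k h) (z l (k * h) g) (gact l (z k h g)) (z (l * k) h g) (z l k (h * g)).
move=> a c e d b ace.
have -> : (a - b + c - d + e = a + c + e - (d + b))%R; last by rewrite ace subrr.
by rewrite opprD !addrA (addrAC a (- b)%R) (addrAC _ (- d)%R) (addrAC _ (- b)%R e) addrAC.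
Qed.

Definition cocycle3 : cocycles_cpt M 3 :=
  exist _ cocycle3_fun (conj cocycle3_fun_cpt cocycle3_fun_cocycle).

End LiftingSystems.

Section Maps.
Variables (U : Type -> Prop) (G : groupType) (M : gmodule G).

Definition ext_class : extension_in M U -> Ext2 M U := @class_of _ _.

Definition cpt_class : cocycles_cpt M 3 -> cohomology_cpt M 3 := @class_of _ _.

(** [cl_map] and [e_map] are defined through arbitrary representatives and an
    arbitrary lifting system; neither choice matters. *)
Definition cl_ext (E : extension M) : cohomology_cpt M 3 :=
  cpt_class (cocycle3 (projT1 (cid (lifting_system_exists E)))).

Definition cl_map (C : Ext2 M U) : cohomology_cpt M 3 :=
  cl_ext (proj1_sig (class_repr C)).

Hypotheses (hU : grothendieck_universe U) (Uinf : has_infinite_set U).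
Hypotheses (UG : U (G : Type)) (UM : U (M : Type)).

Definition std_extension_U (z : cocycles_cpt M 3) : extension_in M U :=
  exist _ (std_extension z) (std_extension_in z hU Uinf UG UM).

Definition e_map (c : cohomology_cpt M 3) : Ext2 M U :=
  ext_class (std_extension_U (class_repr c)).

End Maps.

(* Main.v *)
From HB Require Import structures.
From Stdlib Require Import Relation_Definitions Relation_Operators.
From mathcomp Require Import all_boot ssralg ssrint.
From mathcomp Require Import boolp.
Require Import Defs.

(** The class of the 3-cocycle of a crossed module extension determines the
    extension, because of two facts.

    First, the class does not depend on the choices made.  Two lifting systems of
    [E] differ by a change of the section [G -> Gp E], which can be compensated so
    that the cocycle stays the same ([zval_change_lift1]), and by a componentwise
    pointed cochain [b : G * G -> M], which changes the cocycle by its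
    differential ([zval_shift_lift2]).  Extension equivalences transport lifting
    systems without changing the cocycle ([cocycle3_push]).  Hence [cl] is well
    defined ([cocycle3_class_approx]).

    Second, if [z] is the cocycle of a lifting system [s] of [E], there is an
    extension equivalence from the standard extension of [z] to [E]
    ([std_mor_equivalence]).  On group parts it sends the basis element of [g] to
    [lift1 s g]; on module parts it is [iota] on [M] and sends [z^2(h, g)] to
    [lift2 s h g].  The action of the standard extension is made for this map to
    be equivariant: the relation that defines [z] from [s] is the equivariance
    on the elements [z^2(h, g)], and it propagates along words of the free group
    ([act_lift_free]).

    Everything follows.  Since [z] is the cocycle of the standard extension of
    [z] ([cocycle3_std_lifting]), [cl] after [e] is the identity; by the second
    fact, [e] after [cl] is the identity.  If [y = z + db] with [b]
    componentwise pointed, then [y] is the cocycle of a shifted lifting system of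
    the standard extension of [z], so the second fact also shows that [e] is well
    defined; that [b] may be taken componentwise pointed is
    [cohomologous_cpt_diff2].  The trivial extension has a lifting system with
    constant second component, hence cocycle [0].  Finally every 3-cocycle is
    cohomologous to a componentwise pointed one ([cohomologous_cocycle_cpt]), so
    that componentwise pointed cohomology agrees with ordinary cohomology in
    degree 3. *)

Set Implicit Arguments.
Unset Strict Implicit.
Unset Printing Implicit Defensive.

Import GRing.Theory.
Local Open Scope group_scope.

(** * Pointed and unpointed cohomology in degree 3 *)

Section Cohomology.
Variables (G : groupType) (M : gmodule G).

Lemma differentialB n (b c : cochain M n) :
  differential (b \- c)%R =1 (differential b \- differential c)%R.
Proof.
move=> g; rewrite /differential /= gactD gactN.
under eq_bigr do rewrite mulrzBl.
rewrite sumrB mulrzBl !opprD !addrA.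
by rewrite (ACl (1*3*5*2*4*6))%AC.
Qed.

Lemma coboundary0 n : @coboundary G M n (fun=> 0%R).
Proof.
case: n => // n; exists (fun=> 0%R) => g.
by rewrite (@zero_cocycle G M n g).
Qed.

Lemma coboundaryB n (b c : cochain M n) :
  coboundary b -> coboundary c -> coboundary (b \- c)%R.
Proof.
case: n b c => [|n] b c /=; first by move=> b0 c0 g; rewrite /= b0 c0 subr0.
move=> [b' bE] [c' cE]; exists (b' \- c')%R => g.
by rewrite differentialB /= bE cE.
Qed.

Lemma cptB n (b c : cochain M n) : cpt b -> cpt c -> cpt (b \- c)%R.
Proof. by move=> b0 c0 g g1; rewrite /= b0 // c0 // subr0. Qed.

Lemma cohomologous_equiv n : equivalence _ (@cohomologous G M n).
Proof.
have sym (x y : cocycles M n) : cohomologous x y -> cohomologous y x.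
  move/(coboundaryB (@coboundary0 n)); rewrite /cohomologous; congr coboundary.
  by apply/funext => g /=; rewrite sub0r opprB.
split=> [x|x y t xy yt|//].
- by rewrite /cohomologous (_ : (_ \- _)%R = fun=> 0%R);
    [exact: coboundary0|apply/funext => g /=; rewrite subrr].
- have := coboundaryB yt (sym _ _ xy); congr coboundary.
  by apply/funext => g /=; rewrite opprB addrA subrK.
Qed.

Lemma cohomologous_cptE n (x y : cocycles_cpt M n) :
  cohomologous_cpt x y <-> coboundary (sval y \- sval x)%R.
Proof.
rewrite /cohomologous_cpt /=; split=> [[]//|xy]; split=> // {xy}.
by apply: cptB; [case: (svalP y)|case: (svalP x)].
Qed.

Definition cocycles_of_cpt n (x : cocycles_cpt M n) : cocycles M n :=
  exist _ (sval x) (proj2 (svalP x)).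

Lemma cohomologous_cpt_equiv n : equivalence _ (@cohomologous_cpt G M n).
Proof.
have E (x y : cocycles_cpt M n) :
  cohomologous_cpt x y <-> cohomologous (cocycles_of_cpt x) (cocycles_of_cpt y).
  exact: cohomologous_cptE.
have [r t s] := cohomologous_equiv n.
split=> [x|x y u|x y]; first exact/E/r.
- by move=> /E xy /E yu; apply/E; apply: t xy yu.
- by move=> /E xy; apply/E/s.
Qed.

Lemma gvec3K (v : gpow G 3) :
  gvec [tuple v (inord 2); v (inord 1); v (inord 0)] = v.
Proof.
by apply/ffunP=> -[[|[|[|//]]] i]; rewrite ffunE (tnth_nth 1) /=;
  congr (v _); apply: val_inj; rewrite /= inordK.
Qed.

Lemma gvec2K (v : gpow G 2) : gvec [tuple v (inord 1); v (inord 0)] = v.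
Proof.
by apply/ffunP=> -[[|[|//]] i]; rewrite ffunE (tnth_nth 1) /=;
  congr (v _); apply: val_inj; rewrite /= inordK.
Qed.

Definition cochain2 (b : G -> G -> M) : cochain M 2 :=
  fun v => b (v (inord 1)) (v (inord 0)).

Lemma cochain2E b h g : cochain2 b (gvec [tuple h; g]) = b h g.
Proof. by rewrite /cochain2 !ffunE !(tnth_nth 1) /= !inordK. Qed.

(** The differential of a 2-cochain, with the components of the argument as
    separate variables. *)
Definition diff2 (b : G -> G -> M) (k h g : G) : M :=
  (b k h - b k (h * g)%g + b (k * h)%g g - gact k (b h g))%R.

Lemma differential2E (c : cochain M 2) (k h g : G) :
  differential c (gvec [tuple k; h; g]) =
    diff2 (fun x y => c (gvec [tuple x; y])) k h g.
Proof.
have E (s t : gpow G 2) : s (inord 0%N) = t (inord 0%N) ->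
    s (inord 1%N) = t (inord 1%N) -> s = t.
  by move=> e0 e1; rewrite -[s]gvec2K -[t]gvec2K e0 e1.
rewrite /differential /diff2 2?big_ltn // big_geq //=.
rewrite (_ : ord_max = inord 2%N :> 'I_3); last by apply: val_inj; rewrite /= inordK.
rewrite ffunE (tnth_nth 1) /= inordK //.
rewrite !exprS expr0 !mulN1r !mulrNz !opprK !mulr1z !addr0 !addrA.
by do !congr (_ + _)%R; rewrite ?opprK; do ?[congr (- _)%R]; do ?[congr (gact _ _)];
  congr (c _); apply: E; rewrite !ffunE !(tnth_nth 1) /= !inordK.
Qed.

Lemma differential_cochain2 b k h g :
  differential (cochain2 b) (gvec [tuple k; h; g]) = diff2 b k h g.
Proof. by rewrite differential2E /diff2 !cochain2E. Qed.

Lemma differentialK2 (b : cochain M 2) : cocycle (differential b).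
Proof.
apply/cocycle3E => l k h g; rewrite !differential2E /diff2 !gactD !gactN !gactM.
rewrite -!mulgA !(opprD, opprK) !addrA.
(* Twenty terms that cancel in pairs: sort them so that each one stands next
   to its opposite. *)
by rewrite (ACl (1*5*3*13*6*10*8*18*11*15*16*20*9*2*14*7*17*4*19*12))%AC
  /= subrr add0r !addrK subrr.
Qed.

Lemma cpt3 (c : cochain M 3) :
  (forall k h g, k = 1 \/ h = 1 \/ g = 1 -> c (gvec [tuple k; h; g]) = 0%R) ->
  cpt c.
Proof.
move=> c1 v [i vi]; rewrite -[v]gvec3K; apply: c1.
case: i vi => [[|[|[|//]]] i] /= <-; [right; right|right; left|left];
  by congr (v _); apply: val_inj; rewrite /= inordK.
Qed.

(** Why [forget_cpt] is surjective.  The cocycle identity at [(k, 1, 1, g)] gives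
    [z k 1 g = z k 1 1 + k . z 1 1 g], which is the value at [(k, 1, g)] of the
    differential of [b] below; so [y = z - db] vanishes there.  The cocycle
    identities of [y] at [(1, 1, h, g)] and at [(k, h, 1, 1)] then force [y] to
    vanish at [(1, h, g)] and [(k, h, 1)] as well. *)
Lemma cohomologous_cocycle_cpt (z : cocycles M 3) :
  exists y : cocycles_cpt M 3, cohomologous (cocycles_of_cpt y) z.
Proof.
case: z => c cz; pose zf k h g := c (gvec [tuple k; h; g]).
have zc l k h g : (zf l k h - zf l k (h * g)%g + zf l (k * h)%g g
    - zf (l * k)%g h g + gact l (zf k h g))%R = 0%R.
  exact: (cocycle3E c).1.
pose b (h g : G) : M :=
  if g == 1 then zf h 1 1 else if h == 1 then (- zf 1%g 1%g g)%R else 0%R.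
pose y := (c \- differential (cochain2 b))%R.
have yc : cocycle y by move=> v; rewrite differentialB /= cz differentialK2 subr0.
pose yf k h g := y (gvec [tuple k; h; g]).
have yE k h g : yf k h g = (zf k h g - diff2 b k h g)%R.
  by rewrite /yf /y /= differential_cochain2.
have yfc l k h g : (yf l k h - yf l k (h * g)%g + yf l (k * h)%g g
    - yf (l * k)%g h g + gact l (yf k h g))%R = 0%R.
  exact: (cocycle3E y).1.
have z111 : zf 1 1 1 = 0%R.
  by have := zc 1 1 1 1; rewrite !mulg1 gact1 subrr add0r subrr add0r.
have bl g : b 1 g = (- zf 1%g 1%g g)%R.
  by rewrite /b eqxx; case: eqP => // ->; rewrite z111 oppr0.
have br h : b h 1 = zf h 1 1 by rewrite /b eqxx.
have y_1_ k g : yf k 1 g = 0%R.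
  have := zc k 1 1 g; rewrite !mul1g !mulg1 subrK => zk.
  rewrite yE /diff2 mul1g mulg1 bl br gactN opprK subrK -[RHS]oppr0 -{}zk.
  by rewrite !opprD opprK addrA [(- zf k 1%g 1%g + _)%R]addrC.
have y1__ h g : yf 1 h g = 0%R.
  by have := yfc 1 1 h g; rewrite !mul1g !y_1_ gact1 subrK subr0 add0r.
have y__1 k h : yf k h 1 = 0%R.
  by have := yfc k h 1 1; rewrite !mulg1 !y_1_ gact0 addr0 subr0 subrr add0r.
have y_cpt : cpt y.
  apply: cpt3 => k h g [->|[->|->]]; [exact: y1__|exact: y_1_|exact: y__1].
exists (exist _ y (conj y_cpt yc)); exists (cochain2 b) => v /=.
by rewrite opprB addrC subrK.
Qed.

(** A coboundary that is componentwise pointed is the differential of a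
    componentwise pointed cochain.  If [db] vanishes at [(1, 1, g)] and
    [(h, 1, 1)], then [b 1 g = b 1 1] and [b h 1 = h . b 1 1]; hence [b] minus
    the 2-cocycle [h, g |-> h . b 1 1] is pointed.  Pointedness is what makes
    such a cochain usable for changing a lifting system. *)
Lemma cohomologous_cpt_diff2 (x y : cocycles_cpt M 3) :
  cohomologous_cpt x y -> exists2 b : G -> G -> M,
    forall h g, h = 1 \/ g = 1 -> b h g = 0%R &
    forall k h g, zval y k h g = (zval x k h g + diff2 b k h g)%R.
Proof.
move=> /cohomologous_cptE [c cE].
pose b h g := c (gvec [tuple h; g]).
have bE k h g : diff2 b k h g = (zval y k h g - zval x k h g)%R.
  by rewrite -differential2E -cE.
pose b1 h g := (b h g - gact h (b 1%g 1%g))%R.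
have b1E k h g : diff2 b1 k h g = diff2 b k h g.
  rewrite /diff2 /b1 gactD gactN !gactM !(opprD, opprK) !addrA.
  by rewrite (ACl (1*3*5*7*2*4*6*8))%AC /= !subrK.
have bl g : b 1 g = b 1 1.
  have := bE 1 1 g; rewrite !zval_cpt ?subrr; [|by left|by left].
  by rewrite /diff2 !mul1g gact1 subrK => /eqP; rewrite subr_eq0 => /eqP.
have br h : b h 1 = gact h (b 1 1).
  have := bE h 1 1; rewrite !zval_cpt ?subrr; [|by right; left|by right; left].
  by rewrite /diff2 !mulg1 subrr add0r => /eqP; rewrite subr_eq0 => /eqP.
exists b1 => [h g|k h g]; last by rewrite b1E bE addrC subrK.
by rewrite /b1 => -[]->; [rewrite bl gact1 subrr|rewrite br subrr].
Qed.

Lemma cohomologous_cpt_of_diff2 (x y : cocycles_cpt M 3) (b : G -> G -> M) :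
  (forall k h g, zval y k h g = (zval x k h g + diff2 b k h g)%R) ->
  cohomologous_cpt x y.
Proof.
move=> xy; apply/cohomologous_cptE; exists (cochain2 b) => v.
rewrite -[v]gvec3K differential_cochain2 [LHS]/=.
by rewrite -!/(zval _ _ _ _) xy addrC addKr.
Qed.

Lemma cocycle_cpt_eq (x y : cocycles_cpt M 3) :
  (forall k h g, zval x k h g = zval y k h g) -> x = y.
Proof.
case: x y => [x px] [y py] xy; apply: eq_exist; apply/funext => v.
by rewrite -[v]gvec3K; apply: xy.
Qed.

(** The map [H^3_cpt -> H^3] induced by the inclusion of cocycles. *)
Definition forget_cpt (C : cohomology_cpt M 3) : cohomology M 3 :=
  class_of _ (cocycles_of_cpt (class_repr C)).

(** Injectivity holds because a difference of componentwise pointed cochains is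
    componentwise pointed, so that both equivalence relations agree on
    componentwise pointed cocycles. *)
Lemma forget_cpt_bij : bijective forget_cpt.
Proof.
pose g (D : cohomology M 3) : cohomology_cpt M 3 :=
  class_of _ (projT1 (cid (cohomologous_cocycle_cpt (class_repr D)))).
have [_ tr _] := cohomologous_equiv 3.
have E x y : class_of (@cohomologous_cpt G M 3) x = class_of _ y <->
    cohomologous (cocycles_of_cpt x) (cocycles_of_cpt y).
  rewrite (class_of_eq (cohomologous_cpt_equiv 3)); exact: cohomologous_cptE.
exists g => [C|D]; rewrite /g /forget_cpt.
- case: cid => y yC; rewrite -[RHS]class_reprK; apply/E.
  apply: (tr _ _ _ yC).
  exact/(class_of_eq (cohomologous_equiv 3))/class_reprK.
- case: cid => y yD; rewrite -[RHS]class_reprK.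
  apply/(class_of_eq (cohomologous_equiv 3)); apply: (tr _ _ _ _ yD).
  exact/E/class_reprK.
Qed.

End Cohomology.

(** * Dependence of the cocycle on the lifting system *)

Section Liftings.
Variables (G : groupType) (M : gmodule G).

Lemma iotaD (E : extension M) (a b : M) : iota E (a + b)%R = iota E a * iota E b.
Proof. exact: (gmulfM (s := iota E)). Qed.

Lemma iota0 (E : extension M) : iota E (0%R : M) = 1.
Proof. by apply: (mulgI (iota E 0%R)); rewrite -iotaD addr0 mulg1. Qed.

Lemma iotaN (E : extension M) (a : M) : iota E (- a)%R = (iota E a)^-1.
Proof. by apply: (mulgI (iota E a)); rewrite -iotaD subrr iota0 mulgV. Qed.

Lemma mu_iota (E : extension M) (a : M) : xmu E (iota E a) = 1.
Proof. by apply/exact_Mp; exists a. Qed.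

Lemma zval_cocycle3 (E : extension M) (s : lifting_system E) k h g :
  zval (cocycle3 s) k h g = iota_inv (cocycle3_val s k h g).
Proof. by rewrite /zval /= /cocycle3_fun !ffunE !(tnth_nth 1) /= !inordK. Qed.

Lemma iota_zval (E : extension M) (s : lifting_system E) k h g :
  lift2 s k h * lift2 s (k * h) g = iota E (zval (cocycle3 s) k h g) *
    xact (lift1 s k) (lift2 s h g) * lift2 s k (h * g).
Proof. by rewrite zval_cocycle3 iota_cocycle3 lift2_mul. Qed.

(** The cocycle of a lifting system is the only solution of the associativity
    equation [iota_zval].  All cocycles below are computed by checking this
    equation. *)
Lemma zval_unique (E : extension M) (s : lifting_system E) (k h g : G) (a : M) :
  lift2 s k h * lift2 s (k * h) g =
    iota E a * xact (lift1 s k) (lift2 s h g) * lift2 s k (h * g) ->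
  zval (cocycle3 s) k h g = a.
Proof. by rewrite iota_zval => /mulIg/mulIg/iota_inj. Qed.

(** As [iota] has central values, multiplying the second component of a lifting
    system by [iota] of a componentwise pointed 2-cochain [b] adds the
    differential of [b] to the cocycle. *)
Section Shift.
Variables (E : extension M) (s : lifting_system E) (b : G -> G -> M).
Hypothesis b1 : forall h g, h = 1 \/ g = 1 -> b h g = 0%R.

Let shift2 h g := iota E (b h g) * lift2 s h g.

Fact shift2_cpt h g : h = 1 \/ g = 1 -> shift2 h g = 1.
Proof. by move=> hg; rewrite /shift2 b1 // iota0 lift2_cpt ?mul1g. Qed.

Fact mu_shift2 h g :
  xmu E (shift2 h g) = lift1 s h * lift1 s g * (lift1 s (h * g))^-1.
Proof. by rewrite gmulfM mu_iota mul1g mu_lift2. Qed.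

Definition shift_lift2 : lifting_system E :=
  LiftingSystem (lift1_pointed s) (lift1K s) shift2_cpt mu_shift2.

Lemma zval_shift_lift2 k h g :
  zval (cocycle3 shift_lift2) k h g = (zval (cocycle3 s) k h g + diff2 b k h g)%R.
Proof.
have iC := iota_central (E := E).
apply: zval_unique; rewrite /= /shift2.
rewrite xactD act_iota lift1K -!mulgA (mulgA (lift2 s k h)) -iC.
rewrite -!mulgA iota_zval !mulgA.
rewrite -!/(zval _ _ _ _) -[X in _ = X * lift2 s k (h * g)]iC.
rewrite !mulgA -!iotaD; congr (iota E _ * _ * _).
by rewrite /diff2 !addrA subrK [RHS](ACl (3*5*2*1*4))%AC /= addrK.
Qed.

End Shift.

(** Replacing the first component by another pointed section [t] does not change
    the cocycle at all, if the second component is corrected by the elements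
    [c g] of the module part that measure the difference between the sections. *)
Section Change.
Variables (E : extension M) (s : lifting_system E) (t : G -> Gp E) (c : G -> Mp E).
Hypothesis c1 : c 1 = 1.
Hypothesis mu_c : forall g, xmu E (c g) = t g * (lift1 s g)^-1.

Let tE g : t g = xmu E (c g) * lift1 s g.
Proof. by rewrite mu_c mulgVK. Qed.

Let change2 h g :=
  c h * xact (lift1 s h) (c g) * lift2 s h g * (c (h * g))^-1.

Fact change1_pointed : t 1 = 1.
Proof. by rewrite tE c1 gmulf1 lift1_pointed mulg1. Qed.

Fact change1K g : ext_pi E (t g) = g.
Proof.
rewrite tE gmulfM lift1K (exact_Gp _).2 ?mul1g //; exact: (ex_intro _ (c g)).
Qed.

Fact change2_cpt h g : h = 1 \/ g = 1 -> change2 h g = 1.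
Proof.
rewrite /change2 => hg; rewrite (lift2_cpt s hg) mulg1.
case: hg => ->; first by rewrite c1 lift1_pointed xact1 !mul1g mulgV.
by rewrite c1 xact_1 !mulg1 mulgV.
Qed.

Fact mu_change2 h g : xmu E (change2 h g) = t h * t g * (t (h * g))^-1.
Proof.
rewrite !gmulfM gmulfV xmu_act mu_lift2 !mu_c !invgM !invgK !mulgA.
by rewrite !(mulgVK, mulgK).
Qed.

Definition change_lift1 : lifting_system E :=
  LiftingSystem change1_pointed change1K change2_cpt mu_change2.

Lemma zval_change_lift1 k h g :
  zval (cocycle3 change_lift1) k h g = zval (cocycle3 s) k h g.
Proof.
have iC := iota_central (E := E).
apply: zval_unique; rewrite /= /change2 tE xactM xpeiffer -!/(zval _ _ _ _).
rewrite !xactD !xact_V -!mulgA !mulKg !mulgA; congr (_ * _).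
(* [lift2_act] brings the left-hand side to the form
   [c k * k.(c h) * k.(h.(c g))] times the left-hand side of [iota_zval]. *)
rewrite -(mulgA _ (lift2 s k h)) lift2_act -!mulgA iota_zval !mulgA.
by rewrite -[X in X * _ * _ = _]iC !mulgA.
Qed.

End Change.

Lemma cocycle3_eq (E : extension M) (s s' : lifting_system E) :
  lift1 s =1 lift1 s' -> lift2 s =2 lift2 s' -> cocycle3 s = cocycle3 s'.
Proof.
move=> e1 e2; apply: cocycle_cpt_eq => k h g.
by apply: zval_unique; rewrite e1 !e2 iota_zval.
Qed.

Lemma cpt_classP (x y : cocycles_cpt M 3) :
  cpt_class x = cpt_class y <-> cohomologous_cpt x y.
Proof. exact: (class_of_eq (@cohomologous_cpt_equiv G M 3) x y). Qed.

(** Any two lifting systems of an extension differ by a change of the section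
    followed by a shift: once the sections agree, the second components have the
    same image under the structure morphism, hence differ by a cochain with
    values in [M]. *)
Lemma cocycle3_class_lifting (E : extension M) (s s' : lifting_system E) :
  cpt_class (cocycle3 s) = cpt_class (cocycle3 s').
Proof.
have exc g : exists m, xmu E m = lift1 s' g * (lift1 s g)^-1.
  by apply/exact_Gp; rewrite gmulfM gmulfV !lift1K mulgV.
pose c g := if g == 1 then 1 else projT1 (cid (exc g)).
have c1 : c 1 = 1 by rewrite /c eqxx.
have mu_c g : xmu E (c g) = lift1 s' g * (lift1 s g)^-1.
  rewrite /c; case: eqP => [->|_]; last by case: cid.
  by rewrite gmulf1 !lift1_pointed mulgV.
pose s1 := change_lift1 c1 mu_c.
pose b h g := iota_inv (lift2 s' h g * (lift2 s1 h g)^-1).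
have b1 h g : h = 1 \/ g = 1 -> b h g = 0%R.
  by move=> hg; rewrite /b !(lift2_cpt _ hg) mulgV -(iota0 E) iotaK.
have s2E : cocycle3 s' = cocycle3 (shift_lift2 s1 b1).
  apply: cocycle3_eq => // h g; rewrite /= iota_invK ?mulgVK //.
  by rewrite gmulfM gmulfV !mu_lift2 mulgV.
apply/cpt_classP/(cohomologous_cpt_of_diff2 (b := b)) => k h g.
by rewrite s2E zval_shift_lift2 zval_change_lift1.
Qed.

(** An extension equivalence respects all data in the equation [iota_zval] and is
    the identity on [M], so the image of a lifting system has the same cocycle. *)
Section Push.
Variables (E E' : extension M) (phi : crossed_module_morphism E E').
Hypothesis phiE : extension_equivalence phi.
Variable s : lifting_system E.

Fact push1_pointed : Gp_mor phi (lift1 s 1) = 1.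
Proof. by rewrite lift1_pointed gmulf1. Qed.

Fact push1K g : ext_pi E' (Gp_mor phi (lift1 s g)) = g.
Proof. by rewrite phiE.2 lift1K. Qed.

Fact push2_cpt h g : h = 1 \/ g = 1 -> Mp_mor phi (lift2 s h g) = 1.
Proof. by move=> hg; rewrite lift2_cpt // gmulf1. Qed.

Fact mu_push2 h g : xmu E' (Mp_mor phi (lift2 s h g)) =
  Gp_mor phi (lift1 s h) * Gp_mor phi (lift1 s g)
    * (Gp_mor phi (lift1 s (h * g)))^-1.
Proof. by rewrite mor_mu mu_lift2 !gmulfM gmulfV. Qed.

Definition push_lifting : lifting_system E' :=
  LiftingSystem push1_pointed push1K push2_cpt mu_push2.

Lemma cocycle3_push : cocycle3 push_lifting = cocycle3 s.
Proof.
apply: cocycle_cpt_eq => k h g; apply: zval_unique => /=.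
by rewrite -(mor_act phi) -phiE.1 -!gmulfM iota_zval.
Qed.

End Push.

Variable U : Type -> Prop.

Lemma ext_approx_equiv : equivalence _ (@ext_approx G M U).
Proof.
split=> [x|x y z|x y]; [exact: rst_refl|exact: rst_trans|exact: rst_sym].
Qed.

Lemma ext_classP (E E' : extension_in M U) :
  ext_class E = ext_class E' <-> ext_approx E E'.
Proof. exact: (class_of_eq ext_approx_equiv E E'). Qed.

(** [cocycle3_push] and [cocycle3_class_lifting] settle a generating step of the
    relation; a chain of steps is handled by choosing a lifting system of each
    intermediate extension. *)
Lemma cocycle3_class_approx (E E' : extension_in M U) : ext_approx E E' ->
  forall (s : lifting_system (proj1_sig E)) (s' : lifting_system (proj1_sig E')),
  cpt_class (cocycle3 s) = cpt_class (cocycle3 s').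
Proof.
elim=> {E E'} [E E' [phi phiE]|E|E E' _ IH|E1 E2 E3 _ IH12 _ IH23] s s'.
- rewrite -(cocycle3_push phiE); exact: cocycle3_class_lifting.
- exact: cocycle3_class_lifting.
- by rewrite (IH s' s).
- have [t _] := lifting_system_exists (proj1_sig E2).
  by rewrite (IH12 s t) (IH23 t s').
Qed.

End Liftings.

(** * From the standard extension to an extension *)

(** Throughout, [s] is a lifting system of [E], and the standard extension of
    its cocycle is compared with [E]. *)
Section Compare.
Variables (G : groupType) (M : gmodule G) (E : extension M) (s : lifting_system E).

Notation F := (std_free G).

(** Induction on the free group for statements about the right action of
    [std_free G] on the set [G] through the projection.  As the step is an
    equivalence valid at every point [x], it also covers the inverses of the
    generators. *)
Lemma std_free_ind (P : G -> F -> Prop) : (forall x, P x 1) ->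
  (forall x y w, P x (std_gen y * w) <-> P (x * y) w) -> forall w x, P x w.
Proof.
move=> P1 PM; apply: pf_ind => [//|y w IHw x|y w IHw x].
  exact/PM/IHw.
have := IHw (x * y^-1).
by rewrite -{1}(mulVKg (std_gen y) w) PM mulgVK.
Qed.

(** A homomorphism from the kernel of the projection to [Mp E] with
    [std_z2 h g |-> lift2 s h g] is obtained without a basis of that kernel, by
    the construction that yields [fox]: the free group acts from the right on
    [Mp E * G] by [(m, x) * std_gen g = (m * lift2 s x g, x * g)], and
    [lift_word x w] is the first component of [(1, x) * w]. *)
Definition lift_letter (x : G) (a : letter G) : Mp E :=
  if a.2 then lift2 s x a.1 else (lift2 s (x * a.1^-1) a.1)^-1.

Fixpoint lift_word (x : G) (w : seq (letter G)) : Mp E :=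
  if w is a :: w' then lift_letter x a * lift_word (x * letter_val id a) w' else 1.

Lemma lift_letterV x a :
  lift_letter x a * lift_letter (x * letter_val id a) (letter_inv a) = 1.
Proof.
by case: a => g []; rewrite /lift_letter /letter_val /= ?mulgK ?mulVg ?mulgV.
Qed.

Lemma lift_word_push x a w :
  lift_word x (push 1 a w) = lift_letter x a * lift_word (x * letter_val id a) w.
Proof.
rewrite /push; case: eqP => [a1|_].
  rewrite /lift_letter /letter_val a1 invg1 if_same mulg1 !lift2_cpt;
    by [right|rewrite invg1 if_same mul1g].
case: w => [|b w] //; case: eqP => // -> /=.
rewrite mulgA lift_letterV mul1g; congr (lift_word _ w).
by rewrite /letter_val /=; case: a.2; rewrite /= ?mulgK ?mulgVK.
Qed.

Lemma lift_word_mul x u v :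
  lift_word x (word_mul 1 u v) = lift_word x u * lift_word (x * word_val id u) v.
Proof.
elim: u x => [|a u IHu] x /=; first by rewrite /word_val big_nil mulg1 mul1g.
by rewrite lift_word_push IHu mulgA /word_val big_cons mulgA.
Qed.

Definition lift_free (x : G) (w : F) : Mp E := lift_word x (word w).

Lemma lift_free1 x : lift_free x 1 = 1.
Proof. by []. Qed.

Lemma lift_freeM x (u v : F) :
  lift_free x (u * v) = lift_free x u * lift_free (x * std_pi u) v.
Proof. exact: lift_word_mul. Qed.

Lemma lift_free_gen x y : lift_free x (std_gen y) = lift2 s x y.
Proof. by rewrite /lift_free /= lift_word_push /= mulg1. Qed.

Lemma fox_genM (k x y : G) (w : F) :
  fox (cocycle3 s) k x (word (std_gen y * w)) =
  (- zval (cocycle3 s) k x y + fox (cocycle3 s) k (x * y)%g (word w))%R.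
Proof. by rewrite foxM std_pi_gen /= fox_push /= addr0. Qed.

Definition free_lift : F -> Gp E := pf_lift (lift1 s).

HB.instance Definition _ :=
  monoid.isUMagmaMorphism.Build F (Gp E) free_lift (pf_lift_is_hom (lift1_pointed s)).

Lemma free_lift_gen g : free_lift (std_gen g) = lift1 s g.
Proof. by rewrite /free_lift pf_lift_gen ?lift1_pointed. Qed.

Lemma free_liftM u v : free_lift (u * v) = free_lift u * free_lift v.
Proof. exact: gmulfM. Qed.

(** Along a word the factors [lift1 s (x * g)] telescope. *)
Lemma mu_lift_free w x :
  xmu E (lift_free x w) = lift1 s x * free_lift w * (lift1 s (x * std_pi w))^-1.
Proof.
move: w x; apply: std_free_ind => [x|x y w].
  by rewrite !gmulf1 !mulg1 mulgV.
rewrite lift_freeM lift_free_gen gmulfM mu_lift2 free_liftM free_lift_gen.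
rewrite std_piM std_pi_gen (mulgA x y) -!mulgA.
split=> [/mulgI/mulgI/(canRL (mulVKg _)) //|->].
by rewrite mulKg.
Qed.

(** The associativity equation [iota_zval], extended from generators to words:
    [fox] collects the cocycle values that occur.  This is why the action on the
    standard extension is compatible with the action on [E]. *)
Lemma act_lift_free k w x :
  xact (lift1 s k) (lift_free x w) =
  iota E (fox (cocycle3 s) k x (word w)) * lift2 s k x * lift_free (k * x) w *
    (lift2 s k (x * std_pi w))^-1.
Proof.
move: w x; apply: std_free_ind => [x|x y w].
  by rewrite xact_1 iota0 gmulf1 !mulg1 mul1g mulgV.
rewrite !lift_freeM !lift_free_gen xactD fox_genM addrC iotaD iotaN std_piM std_pi_gen.
(* [iota_zval] turns the product of the first two lifts into the cocycle value,
   which cancels the new term of [fox]. *)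
rewrite !mulgA -(mulgA _ (lift2 s k x)) iota_zval !mulgA.
rewrite mulgVK (iota_central _ (xact _ _)) -!mulgA.
by split=> [/mulgI|->].
Qed.

Definition std_Mp_mor (p : std_Mp M) : Mp E := iota E p.1 * lift_free 1 (val p.2).

Lemma std_Mp_mor_is_hom : monoid.monoid_morphism std_Mp_mor.
Proof.
split=> [|[m q] [n r]]; rewrite /std_Mp_mor /=.
  by rewrite lift_free1 mulg1; exact: gmulf1.
rewrite [iota E _]iotaD lift_freeM mul1g [std_pi _](eqP (ker_valP q)).
by rewrite -!mulgA; congr (_ * _); rewrite !mulgA iota_central.
Qed.

HB.instance Definition _ :=
  monoid.isUMagmaMorphism.Build (std_Mp M) (Mp E) std_Mp_mor std_Mp_mor_is_hom.

Lemma mu_std_Mp_mor p : xmu E (std_Mp_mor p) = free_lift (std_mu p).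
Proof.
rewrite /std_Mp_mor gmulfM mu_iota mul1g mu_lift_free mul1g.
by rewrite [std_pi _](eqP (ker_valP p.2)) lift1_pointed invg1 mulg1 mul1g.
Qed.

(** Conjugation by [std_gen k] moves the base point of [lift_free] from [1] to
    [k], and [act_lift_free] does the same up to [fox]. *)
Lemma std_Mp_mor_gen k p : std_Mp_mor (std_act (cocycle3 s) (std_gen k) p) =
  xact (free_lift (std_gen k)) (std_Mp_mor p).
Proof.
case: p => m r; rewrite /std_Mp_mor /std_act /= std_pi_gen free_lift_gen.
have rE : std_pi (ker_val r) = 1 := eqP (ker_valP r).
have kE : std_pi (std_gen k * ker_val r) = k by rewrite std_piM rE mulg1 std_pi_gen.
have kV : lift_free k (std_gen k)^-1 = 1.
  have := lift_freeM 1 (std_gen k) (std_gen k)^-1.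
  by rewrite mulgV lift_free1 mul1g std_pi_gen lift_free_gen lift2_cpt ?mul1g //; left.
rewrite xactD act_iota lift1K act_lift_free rE !mulg1.
rewrite iotaD -mulgA; congr (_ * _).
rewrite lift_freeM mul1g kE kV mulg1 lift_freeM mul1g std_pi_gen lift_free_gen.
have -> : lift2 s 1 k = 1 by apply: lift2_cpt; left.
have -> : lift2 s k 1 = 1 by apply: lift2_cpt; right.
by rewrite invg1 !mulg1 mul1g.
Qed.

Lemma std_Mp_mor_act w p : std_Mp_mor (std_act (cocycle3 s) w p) =
  xact (free_lift w) (std_Mp_mor p).
Proof.
move: w p; apply: pf_ind => [p|y w IHw p|y w IHw p].
- have f1 : free_lift 1 = 1 by exact: gmulf1.
  by rewrite std_act1 f1 xact1.
- by rewrite std_actM free_liftM xactM -IHw std_Mp_mor_gen.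
have yV : free_lift (std_gen y)^-1 = (free_lift (std_gen y))^-1 by exact: gmulfV.
rewrite std_actM free_liftM xactM -IHw yV.
(* Apply the case of a generator to the translate by its inverse. *)
have -> : std_act (cocycle3 s) w p =
    std_act (cocycle3 s) (std_gen y) (std_act (cocycle3 s) (std_gen y)^-1
      (std_act (cocycle3 s) w p)).
  by rewrite -[RHS]std_actM mulgV std_act1.
rewrite std_Mp_mor_gen -[RHS]xactM mulVg xact1.
by rewrite -[in LHS]std_actM mulVg std_act1.
Qed.

Definition std_mor : crossed_module_morphism (std_extension (cocycle3 s)) E :=
  @CrossedModuleMorphism (std_extension (cocycle3 s)) E free_lift std_Mp_mor
    mu_std_Mp_mor std_Mp_mor_act.

Lemma std_mor_equivalence : extension_equivalence std_mor.
Proof.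
split=> [a|w] /=.
  by rewrite /std_Mp_mor lift_free1 mulg1.
apply: (@pf_lift_unique _ _ G (ext_pi E \o free_lift) (@std_pi G)) => g /=.
by rewrite free_lift_gen lift1K std_pi_gen.
Qed.

End Compare.

(** * The standard lifting system *)

Section StandardLifting.
Variables (G : groupType) (M : gmodule G) (z : cocycles_cpt M 3).

Let std_lift2 (h g : G) : std_Mp M := (1, std_z2 h g).

Fact std_lift2_cpt h g : h = 1 \/ g = 1 -> std_lift2 h g = 1.
Proof.
move=> hg; congr (_, _); apply: val_inj; rewrite /= /std_gen.
by case: hg => ->; rewrite pf_gen0 ?mul1g ?mulg1 mulgV.
Qed.

(** The standard extension comes with a lifting system, given by the basis of the
    free group and by the elements on which its action is prescribed. *)
Definition std_lifting : lifting_system (std_extension z) :=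
  @LiftingSystem G M (std_extension z) std_lift2 (@std_gen G) (pf_gen0 _)
    (@std_pi_gen G) std_lift2_cpt (fun _ _ => erefl).

Lemma cocycle3_std_lifting : cocycle3 std_lifting = z.
Proof.
apply: cocycle_cpt_eq => k h g; apply: zval_unique => /=.
rewrite /std_lift2 (std_act_z2 z k h g).
congr (_, _); first by rewrite /= !mulg1; exact: (esym (subrr (zval z k h g : M))).
by apply: val_inj; rewrite /= !mul1g !mulgA !mulgVK.
Qed.

End StandardLifting.

(** * The mutually inverse bijections *)

Section Bijection.
Variables (U : Type -> Prop) (G : groupType) (M : gmodule G).

Lemma cl_map_class (E : extension_in M U) (s : lifting_system (proj1_sig E)) :
  cl_map (ext_class E) = cpt_class (cocycle3 s).
Proof.
apply: cocycle3_class_approx; apply/ext_classP; exact: class_reprK.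
Qed.

Hypotheses (hU : grothendieck_universe U) (Uinf : has_infinite_set U).
Hypotheses (UG : U (G : Type)) (UM : U (M : Type)).

Notation stdU := (std_extension_U hU Uinf UG UM).

Lemma std_extension_cocycle3 (E : extension_in M U)
    (s : lifting_system (proj1_sig E)) :
  ext_class (stdU (cocycle3 s)) = ext_class E.
Proof.
apply/ext_classP/rst_step; exists (std_mor s); exact: std_mor_equivalence.
Qed.

(** Shifting the standard lifting system of the extension of [x] by a pointed
    cochain produces any given cohomologous cocycle [y]; the comparison morphism
    for the shifted system links the standard extensions of [y] and [x]. *)
Lemma std_extension_cohomologous (x y : cocycles_cpt M 3) :
  cohomologous_cpt x y -> ext_class (stdU x) = ext_class (stdU y).
Proof.
move=> /cohomologous_cpt_diff2 [b b1 xy].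
have -> : y = cocycle3 (shift_lift2 (std_lifting x) b1).
  by apply: cocycle_cpt_eq => k h g; rewrite zval_shift_lift2 cocycle3_std_lifting.
by rewrite (@std_extension_cocycle3 (stdU x)).
Qed.

Lemma e_map_class (z : cocycles_cpt M 3) :
  e_map hU Uinf UG UM (cpt_class z) = ext_class (stdU z).
Proof.
by apply: std_extension_cohomologous; apply/cpt_classP; exact: class_reprK.
Qed.

Lemma cl_mapK : cancel (@cl_map U G M) (e_map hU Uinf UG UM).
Proof.
move=> C; rewrite -[C]class_reprK.
have [s _] := lifting_system_exists (proj1_sig (class_repr C)).
by rewrite (cl_map_class s) e_map_class std_extension_cocycle3.
Qed.

Lemma e_mapK : cancel (e_map hU Uinf UG UM) (@cl_map U G M).
Proof.
move=> c; rewrite -[c]class_reprK e_map_class.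
by rewrite (@cl_map_class (stdU _) (std_lifting _)) cocycle3_std_lifting.
Qed.

Lemma cl_map_trivial :
  cl_map (ext_class (trivial_extension_in UG UM)) = cohomology_cpt0 M 3.
Proof.
pose E := trivial_extension M.
have mu1 (h g : G) : xmu E 1 = (h : Gp E) * (g : Gp E) * ((h * g)%g : Gp E)^-1.
  by rewrite mulgV.
pose s := @LiftingSystem G M E (fun _ _ => 1) id erefl (fun=> erefl)
  (fun _ _ _ => erefl) mu1.
rewrite (@cl_map_class (trivial_extension_in UG UM) s); congr class_of.
apply: cocycle_cpt_eq => k h g; apply: zval_unique.
by rewrite xact_1 !mulg1.
Qed.

End Bijection.

Theorem theorem6p11 (U : Type -> Prop) (hU : grothendieck_universe U)
  (Uinf : has_infinite_set U) (G : groupType) (M : gmodule G)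
  (UG : U (G : Type)) (UM : U (M : Type)) :
  (forall (E : extension_in M U) (s : lifting_system (proj1_sig E)),
     cl_map (ext_class E) = cpt_class (cocycle3 s)) /\
  (forall z : cocycles_cpt M 3,
     e_map hU Uinf UG UM (cpt_class z) =
     ext_class (std_extension_U hU Uinf UG UM z)) /\
  cancel (@cl_map U G M) (e_map hU Uinf UG UM) /\
  cancel (e_map hU Uinf UG UM) (@cl_map U G M) /\
  cl_map (ext_class (trivial_extension_in UG UM)) = cohomology_cpt0 M 3 /\
  (exists f : Ext2 M U -> cohomology M 3, bijective f).
Proof.
have clK := cl_mapK hU Uinf UG UM; have eK := e_mapK hU Uinf UG UM.
split; first exact: cl_map_class.
split; first exact: e_map_class.
do 2!split=> //; split; first exact: cl_map_trivial.
exists (@forget_cpt G M \o @cl_map U G M).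
by apply: bij_comp; [exact: forget_cpt_bij|exists (e_map hU Uinf UG UM)].
Qed.
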